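(* Let $U$ be a finite ground set, $f:2^U\to\mathbb{Z}_{\ge 0}$ a monotone submodular function with $Q:=f(U)$, and let $\mathbf{X}_1,\dots,\mathbf{X}_m$ be mutually independent items with costs $c_1,\dots,c_m>0$, each realizing to a random element of $U$ with a known distribution, such that the realizations of all $m$ items always cover $f$. For any integer $r\ge 1$, there is an $r$-round adaptive algorithm for this stochastic submodular cover instance whose expected cost is $O(Q^{1/r}\log Q)$ times the expected cost of an optimal (fully) adaptive solution.
   Context: Stochastic submodular cover: probing item $\mathbf{X}_i$ costs $c_i$ and reveals its realization $X_i\in U$. A set $\mathbf{S}$ of probed items with realization $S=\{X_i:\mathbf{X}_i\in\mathbf{S}\}$ covers $f$ if $f(S)=Q$. A solution must probe items until $f$ is covered (with probability one), and its cost is the expected total cost of probed items (expectation over the realizations). A (fully) adaptive solution chooses each next item to probe based on all realizations observed so far; the optimal adaptive solution is the one of minimum expected cost. An $r$-round adaptive solution proceeds in $r$ rounds: in each round $k\in\{1,\dots,r\}$ it specifies an ordering of all remaining items (which may depend on all realizations observed in rounds $1,\dots,k-1$) and probes items in this order until some stopping rule; it must cover $f$ with probability one. The $O(\cdot)$ hides an absolute constant.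
   Formalization: The factor log Q is replaced by 1 + ln Q, since for Q = 1 the bound O(Q^{1/r} log Q) would be zero and the claim false; for Q ≥ 2 the two agree up to an absolute constant. *)

(* Defs.v *)
From HB Require Import structures.
From mathcomp Require Import all_boot all_order all_algebra.
From mathcomp Require Import all_classical all_reals all_analysis.
Set Implicit Arguments. Unset Strict Implicit. Unset Printing Implicit Defensive.
Import Order.TTheory GRing.Theory Num.Theory.
Local Open Scope ring_scope.

Section StochCover.
Variables (R : realType) (U : finType) (m : nat).

Definition realization := {ffun 'I_m -> U}.

Definition hist := seq ('I_m * U).

Definition probed (H : hist) : seq 'I_m := map fst H.
Definition realized (H : hist) : {set U} := [set u in map snd H].

Definition monotone_fn (f : {set U} -> nat) :=
  forall A B : {set U}, A \subset B -> (f A <= f B)%N.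
Definition submodular_fn (f : {set U} -> nat) :=
  forall A B : {set U}, (f (A :|: B) + f (A :&: B) <= f A + f B)%N.

Definition prob (p : 'I_m -> {ffun U -> R}) (x : realization) : R :=
  \prod_(i < m) p i (x i).

Definition cost_of (c : 'I_m -> R) (H : hist) : R := \sum_(i <- probed H) c i.

(* Given the observations so far, choose the next item (None = stop). *)
Definition apolicy := hist -> option 'I_m.

Fixpoint arun (fuel : nat) (P : apolicy) (x : realization) (H : hist) : hist :=
  match fuel with
  | 0 => H
  | fuel'.+1 =>
      match P H with
      | None => H
      | Some i => if i \in probed H then H
                  else arun fuel' P x (rcons H (i, x i))
      end
  end.

Definition arun_full (P : apolicy) (x : realization) : hist := arun m P x [::].

(* In round k: an ordering of items depending on the history of rounds < k,
   and a stopping rule (depending on everything observed so far). *)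
Record rpolicy (r : nat) := RPolicy {
  rorder : 'I_r -> hist -> seq 'I_m;
  rstop  : 'I_r -> hist -> hist -> bool }.

Fixpoint round_run (L : seq 'I_m) (stop : hist -> hist -> bool)
    (Hprev Hcur : hist) (x : realization) : hist :=
  match L with
  | [::] => Hcur
  | i :: L' =>
      if i \in probed (Hprev ++ Hcur) then round_run L' stop Hprev Hcur x
      else if stop Hprev Hcur then Hcur
      else round_run L' stop Hprev (rcons Hcur (i, x i)) x
  end.

Definition rrun (r : nat) (P : rpolicy r) (x : realization) : hist :=
  foldl (fun H k => H ++ round_run (rorder P k H) (rstop P k) H [::] x)
        [::] (enum 'I_r).

Definition covers_wp1 (p : 'I_m -> {ffun U -> R}) (f : {set U} -> nat)
    (run : realization -> hist) :=
  forall x : realization, 0 < prob p x -> f (realized (run x)) = f [set: U]%SET.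

Definition exp_cost (p : 'I_m -> {ffun U -> R}) (c : 'I_m -> R)
    (run : realization -> hist) : R :=
  \sum_(x : realization) prob p x * cost_of c (run x).

End StochCover.

(* Main.v *)
(* One round is run from a history with residual [rho] until the residual drops
   below [theta = rho / D], probing greedily the item of largest [gain S e / c e],
   where [gain S e] is the expected fraction of the current residual that [e]
   covers, counted on the realizations for which the items of [S] are not yet
   enough.

   The greedy gain is large: let [A] be an adaptive solution, [u] the mass of the
   realizations that [S] leaves unfinished and [B] a budget exceeded by [A] with
   mass at most [u / 2].  Whether [A] probes [e] within budget [B] is independent
   of the realization of [e].  Hence running [A] on a fresh realization, which is
   again conditioned on being unfinished, bounds the best ratio from below by the
   mean gain of a resampled run, and that mean is at least of order [u / D].

   The total gain along any realization is at most [1 + ln D].  Summing by parts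
   against the quantiles of the cost of [A] shows that a round costs
   [O(D (1 + ln D))] times the cost of [A].  With [D = e Q^(1/r)] every round
   divides the residual by [D], so [r] rounds suffice and at most
   [1 + ln Q / ln D] of them cost anything. *)
Require Import Defs.
From HB Require Import structures.
From mathcomp Require Import all_boot all_order all_algebra.
From mathcomp Require Import all_classical all_reals all_analysis.
From mathcomp Require Import ring lra.
Import Order.TTheory GRing.Theory Num.Theory.
Set Implicit Arguments. Unset Strict Implicit. Unset Printing Implicit Defensive.
Local Open Scope ring_scope.

(** * Monotone submodular functions and the gain of an independent set *)

Section Submodular.
Variables (R : realType) (U : finType) (F : {set U} -> R).
Hypothesis F_mono : forall A B : {set U}, A \subset B -> F A <= F B.
Hypothesis F_submod :
  forall A B : {set U}, F (A :|: B) + F (A :&: B) <= F A + F B.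

Lemma marginal_antitone (A B T : {set U}) :
  A \subset B -> F (B :|: T) - F B <= F (A :|: T) - F A.
Proof.
move=> sAB; have := F_submod B (A :|: T).
rewrite finset.setUA (finset.setUidPl sAB).
have : F A <= F (B :&: (A :|: T)).
  by apply: F_mono; rewrite finset.subsetI sAB finset.subsetUl.
lra.
Qed.

(** Adding the elements one by one, each marginal is taken over a base containing [s], hence is at
    most the marginal over [s]. *)
Lemma marginal_image_le (I : finType) (s : {set U}) (J : {set I}) (x : I -> U) :
  F (s :|: [set x i | i in J]) - F s
    <= \sum_(i in J) (F (s :|: [set x i]) - F s).
Proof.
have -> : [set x i | i in J] = \bigcup_(i in J) [set x i].
  apply/setP => v; apply/imsetP/bigcupP => [[i Ji ->]|[i Ji /set1P ->]].
    by exists i => //; rewrite inE.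
  by exists i.
pose K (A : {set U}) (b : R) := F (s :|: A) - F s <= b.
apply: (big_rec2 K); first by rewrite /K finset.setU0 subrr.
move=> i A b _; rewrite /K => IH.
have := @marginal_antitone s (s :|: A) [set x i] (finset.subsetUl _ _).
rewrite -finset.setUA (finset.setUC A); lra.
Qed.

Section Core.
(** [i] stands for a realization, [q] for its unfinished mass, [s i] for what is already covered and
    [T i] for what the adaptive solution adds. *)
Variables (I : finType) (q : I -> R) (s T : I -> {set U}) (theta D : R).
Hypothesis q_ge0 : forall i, 0 <= q i.
Hypothesis theta_gt0 : 0 < theta.
Hypothesis D_gt0 : 0 < D.
Hypothesis F_range : F [set: U]%SET - F finset.set0 <= D * theta.
Let u := \sum_i q i.
Let res i := F [set: U]%SET - F (s i).
Hypothesis res_ge : forall i, 0 < q i -> theta <= res i.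
Hypothesis complete :
  u <= 2 * \sum_(i | F (s i :|: T i) == F [set: U]%SET) q i.

Lemma q_ne0 i : q i != 0 -> 0 < q i.
Proof. by rewrite lt_def q_ge0 andbT. Qed.

(* The bound is tested on the set [W] maximizing [u / (4 D theta) F W - h W]:
   comparing with the empty set shows [h W <= u / 4], comparing with
   [W :|: T i] bounds the mean gain of [T i] over [W] by the right-hand side. *)
Lemma resampled_gain_ge :
  u ^+ 2 <= 16 * D *
    \sum_i q i * \sum_j q j * ((F (s j :|: T i) - F (s j)) / res j).
Proof.
pose h (W : {set U}) := \sum_j q j * ((F (s j :|: W) - F (s j)) / res j).
pose eta := \sum_i q i * h (T i); change (u ^+ 2 <= 16 * D * eta).
have u_ge0 : 0 <= u by apply: sumr_ge0.
have res_gt0 j : 0 < q j -> 0 < res j.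
  by move=> qj; apply: lt_le_trans (res_ge qj).
have h_ge0 W : 0 <= h W.
  apply: sumr_ge0 => j _; have [->|/q_ne0 qj] := eqVneq (q j) 0.
    by rewrite mul0r.
  apply: mulr_ge0 => //; apply: divr_ge0; last exact/ltW/res_gt0.
  by rewrite subr_ge0 F_mono // finset.subsetUl.
have eta_ge0 : 0 <= eta by apply: sumr_ge0 => i _; apply: mulr_ge0.
have [u0|u_neq0] := eqVneq u 0.
  by rewrite u0 expr0n /=; apply: mulr_ge0 => //; apply: mulr_ge0 => //; exact: ltW.
have u_gt0 : 0 < u by rewrite lt_def u_neq0.
(* This prices the bound [D * theta] on the range of [F] at [u / 4]. *)
pose kap := u / (4 * D * theta).
have Dt_gt0 : 0 < 4 * D * theta by rewrite !mulr_gt0.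
have kap_gt0 : 0 < kap by exact: divr_gt0.
pose psi W := kap * F W - h W.
have [W Wmax] : exists W, forall V, psi V <= psi W.
  have [W _ Wm] := @arg_maxP _ R _ (finset.set0 : {set U}) xpredT psi isT.
  by exists W => V; exact: Wm.
have h0 : h finset.set0 = 0.
  by apply: big1 => j _; rewrite finset.setU0 subrr mul0r mulr0.
have hW : h W <= u / 4.
  have := Wmax finset.set0; rewrite /psi h0 => le1.
  have FW : F W <= F [set: U]%SET by apply: F_mono; exact: finset.subsetT.
  have : kap * (F W - F finset.set0) <= kap * (D * theta).
    rewrite ler_pM2l //; apply: le_trans F_range; exact: lerB.
  have -> : kap * (D * theta) = u / 4.
    by rewrite /kap; field; rewrite !gt_eqF.
  rewrite mulrBr; lra.
have gainT i : kap * (F (W :|: T i) - F W) <= h (T i).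
  have := Wmax (W :|: T i); rewrite /psi => le1.
  (* [h] is subadditive, term by term, because marginals decrease. *)
  suff : h (W :|: T i) - h W <= h (T i) by rewrite mulrBr; lra.
  rewrite -sumrB; apply: ler_sum => j _.
  have [->|/q_ne0 qj] := eqVneq (q j) 0; first by rewrite !mul0r subrr.
  rewrite -mulrBr ler_pM2l // -mulrBl ler_pM2r ?invr_gt0 ?res_gt0 //.
  have := @marginal_antitone (s j) (s j :|: W) (T i) (finset.subsetUl _ _).
  rewrite -finset.setUA; lra.
have gainE : kap * \sum_i q i * (F (W :|: T i) - F W) <= eta.
  rewrite mulr_sumr; apply: ler_sum => i _.
  by rewrite mulrCA; apply: ler_wpM2l.
(* When [s i :|: T i] is complete, [res i] is at most the gain of [W] over [s i] plus the gain of
   [T i] over [W]. After division by [res i], the second summand uses [theta <= res i]. *)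
have key : \sum_(i | F (s i :|: T i) == F [set: U]%SET) q i
    <= h W + theta^-1 * \sum_i q i * (F (W :|: T i) - F W).
  rewrite mulr_sumr -big_split /= big_mkcond; apply: ler_sum => i _.
  have [->|/q_ne0 qi] := eqVneq (q i) 0; first by rewrite !mul0r mulr0 addr0 if_same.
  have g1 : 0 <= F (s i :|: W) - F (s i).
    by rewrite subr_ge0 F_mono // finset.subsetUl.
  have g2 : 0 <= F (W :|: T i) - F W.
    by rewrite subr_ge0 F_mono // finset.subsetUl.
  rewrite [theta^-1 * _]mulrCA -mulrDr; case: ifP => [/eqP cpl|_]; last first.
    apply: mulr_ge0 => //; apply: addr_ge0; last by rewrite mulr_ge0 // invr_ge0 ltW.
    by rewrite divr_ge0 // ltW // res_gt0.
  rewrite -{1}[q i]mulr1 ler_pM2l //.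
  have rle : res i <= (F (s i :|: W) - F (s i)) + (F (W :|: T i) - F W).
    have := @marginal_antitone W (s i :|: W) (T i) (finset.subsetUr _ _).
    have : F (s i :|: T i) <= F (s i :|: W :|: T i).
      by apply: F_mono; rewrite finset.setSU // finset.subsetUl.
    rewrite cpl /res; lra.
  have : res i / res i <=
      ((F (s i :|: W) - F (s i)) + (F (W :|: T i) - F W)) / res i.
    by rewrite ler_pM2r ?invr_gt0 ?res_gt0.
  rewrite divff ?gt_eqF ?res_gt0 // mulrDl => /le_trans; apply.
  rewrite lerD2l mulrC ler_wpM2r // lef_pV2 ?posrE ?res_gt0 //; exact: res_ge.
set X := \sum_i q i * _ in gainE key.
move: complete key; set Y := \sum_(i | _) _ => cY kY.
(* The complete mass is at least [u / 2], of which [h W] accounts for at most [u / 4]. *)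
have : u / 4 <= theta^-1 * X.
  move: cY kY hW; generalize (theta^-1 * X) (h W) Y u => a b c d; lra.
have : theta^-1 * X <= 4 * D / u * eta.
  have -> : 4 * D / u = theta^-1 / kap.
    by rewrite /kap; field; rewrite !gt_eqF.
  rewrite -mulrA ler_pM2l ?invr_gt0 // mulrC ler_pdivlMr // mulrC //.
move=> a b; have {}a := le_trans b a.
have : u * (u / 4) <= u * (4 * D / u * eta) by rewrite ler_pM2l.
have -> : u * (4 * D / u * eta) = 4 * D * eta by field.
rewrite expr2; lra.
Qed.
End Core.
End Submodular.

(** * Redrawing one coordinate of a product distribution *)

Section Update.
Variables (U : finType) (m : nat).
Implicit Types (x : realization U m) (e : 'I_m) (v : U) (H : hist U m).

Definition upd x e v : realization U m := [ffun j => if j == e then v else x j].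

Lemma upd_eq x e v : upd x e v e = v.
Proof. by rewrite ffunE eqxx. Qed.

Lemma upd_neq x e v j : j != e -> upd x e v j = x j.
Proof. by rewrite ffunE => /negbTE ->. Qed.

Lemma upd_undo x e v : upd (upd x e v) e (x e) = x.
Proof. by apply/ffunP => j; rewrite !ffunE; case: eqP => [->|]. Qed.

Definition img x (S : {set 'I_m}) : {set U} := [set x i | i in S].

Lemma img_upd x e v (S : {set 'I_m}) : e \notin S -> img (upd x e v) S = img x S.
Proof.
move=> eS; apply: eq_in_imset => j jS; apply: upd_neq.
by apply: contraNneq eS => <-.
Qed.

Lemma img_setU1 x e (S : {set 'I_m}) : img x (e |: S) = img x S :|: [set x e].
Proof. by rewrite /img imsetU1 finset.setUC. Qed.

Definition agrees x H := all (fun iv => x iv.1 == iv.2) H.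

Lemma agrees_upd x e v H : e \notin probed H -> agrees (upd x e v) H = agrees x H.
Proof.
move=> eH; apply: eq_in_all => iv ivH /=; rewrite upd_neq //.
by apply: contraNneq eH => <-; apply: map_f.
Qed.

Lemma realized_img x H : agrees x H -> realized H = img x [set i in probed H].
Proof.
move=> /allP agr; apply/setP => v; rewrite inE; apply/mapP/imsetP.
  move=> [iv ivH ->]; exists iv.1; first by rewrite inE map_f.
  by apply/esym/eqP/agr.
move=> [i]; rewrite inE => /mapP[iv ivH ->] ->; exists iv => //.
by apply/eqP/agr.
Qed.

Variables (R : realType) (p : 'I_m -> {ffun U -> R}).
Hypothesis p_sum1 : forall i, \sum_(v : U) p i v = 1.

(** The swap of [(x, v)] with [(upd x e v, x e)] is an involution preserving the weight
    [prob p x * p e v]. *)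
Lemma prob_resample e (h : realization U m -> R) :
  \sum_x prob p x * h x = \sum_x prob p x * \sum_v p e v * h (upd x e v).
Proof.
have E1 : \sum_x prob p x * h x = \sum_x \sum_v prob p x * p e v * h x.
  by apply: eq_bigr => x _; rewrite -mulr_suml -mulr_sumr p_sum1 mulr1.
have -> : \sum_x prob p x * \sum_v p e v * h (upd x e v) =
    \sum_x \sum_v prob p x * p e v * h (upd x e v).
  by apply: eq_bigr => x _; rewrite mulr_sumr; apply: eq_bigr => v _; rewrite mulrA.
rewrite E1 !pair_big /=.
pose inv (z : realization U m * U) := (upd z.1 e z.2, z.1 e).
have invK : involutive inv.
  by case=> x v; rewrite /inv /= upd_undo upd_eq.
rewrite (reindex_inj (inv_inj invK)); apply: eq_bigr => -[x v] _ /=.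
congr (_ * _); rewrite /prob !(bigD1 (P := xpredT) e) //= upd_eq.
have -> : \prod_(i < m | i != e) p i (upd x e v i) = \prod_(i < m | i != e) p i (x i).
  by apply: eq_bigr => i ie; rewrite upd_neq.
by rewrite mulrAC [RHS]mulrAC [p e v * _]mulrC.
Qed.

(** Under [mu], each item outside [S] is independent of the other items, with law [p e]. Test
    functions express this without normalizing [mu]. *)
Definition resamples (mu : realization U m -> R) (S : {set 'I_m}) :=
  forall e (h : realization U m -> R), e \notin S ->
    \sum_x mu x * h x = \sum_x mu x * \sum_v p e v * h (upd x e v).

Lemma resamples_agrees H :
  resamples (fun x => if agrees x H then prob p x else 0) [set i in probed H].
Proof.
move=> e h; rewrite inE => eH.
have E (g : realization U m -> R) :
    \sum_x (if agrees x H then prob p x else 0) * g x =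
    \sum_x prob p x * (if agrees x H then g x else 0).
  by apply: eq_bigr => x _; case: ifP; rewrite ?mulr0 ?mul0r.
rewrite !E (prob_resample e); apply: eq_bigr => x _; congr (_ * _).
case: ifP => xH; first by apply: eq_bigr => v _; rewrite agrees_upd // xH.
by apply: big1 => v _; rewrite agrees_upd // xH mulr0.
Qed.

(** Neither [P] nor [k x] reads coordinate [e], so the value [x e] can be averaged separately. *)
Lemma resamples_cond (mu : realization U m -> R) (S : {set 'I_m}) e
    (P : pred (realization U m)) (k : realization U m -> U -> R) :
  resamples mu S -> e \notin S ->
  (forall x v, P (upd x e v) = P x) -> (forall x v, k (upd x e v) = k x) ->
  \sum_(x | P x) mu x * k x (x e) =
  \sum_(x | P x) mu x * \sum_v p e v * k x v.
Proof.
move=> rs eS HP Hk; rewrite [LHS]big_mkcond [RHS]big_mkcond /=.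
have -> : \sum_x (if P x then mu x * k x (x e) else 0) =
    \sum_x mu x * (if P x then k x (x e) else 0).
  by apply: eq_bigr => x _; case: ifP; rewrite ?mulr0.
rewrite (rs e) //; apply: eq_bigr => x _.
case: ifP => Px; last by rewrite big1 ?mulr0 // => v _; rewrite HP Px mulr0.
by congr (_ * _); apply: eq_bigr => v _; rewrite HP Px Hk upd_eq.
Qed.
End Update.

(** * Runs of adaptive solutions, with and without a budget *)

Section Runs.
Variables (R : realType) (U : finType) (m : nat) (c : 'I_m -> R).
Hypothesis c_gt0 : forall i, 0 < c i.
Implicit Types (x : realization U m) (e : 'I_m) (v : U) (H : hist U m).

Lemma probed_rcons H e v : probed (rcons H (e, v)) = rcons (probed H) e.
Proof. by rewrite /probed map_rcons. Qed.

Lemma probed_cat H H' : probed (H ++ H') = probed H ++ probed H'.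
Proof. exact: map_cat. Qed.

Lemma agrees_cat x H H' : agrees x (H ++ H') = agrees x H && agrees x H'.
Proof. exact: all_cat. Qed.

Lemma agrees_rcons x H e : agrees x (rcons H (e, x e)) = agrees x H.
Proof. by rewrite -cats1 agrees_cat /= eqxx !andbT. Qed.

Lemma cost_of_rcons H e v : cost_of c (rcons H (e, v)) = cost_of c H + c e.
Proof. by rewrite /cost_of probed_rcons -cats1 big_cat big_seq1. Qed.

Lemma cost_of_cat H H' : cost_of c (H ++ H') = cost_of c H + cost_of c H'.
Proof. by rewrite /cost_of probed_cat big_cat. Qed.

Lemma cost_of_ge0 H : 0 <= cost_of c H.
Proof. by apply: sumr_ge0 => i _; exact: ltW. Qed.

Lemma cost_of_arun_ge n (A : apolicy U m) x H :
  cost_of c H <= cost_of c (arun n A x H).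
Proof.
elim: n H => //= n IH H; case: (A H) => [i|] //; case: ifP => // _.
apply: le_trans (IH _); rewrite cost_of_rcons.
by rewrite lerDl ltW.
Qed.

Lemma mem_probed_arun n (A : apolicy U m) x H e :
  e \in probed H -> e \in probed (arun n A x H).
Proof.
elim: n H => //= n IH H eH; case: (A H) => [i|] //; case: ifP => // _.
by apply: IH; rewrite probed_rcons mem_rcons inE eH orbT.
Qed.

Lemma uniq_probed_arun n (A : apolicy U m) x H :
  uniq (probed H) -> uniq (probed (arun n A x H)).
Proof.
elim: n H => //= n IH H uH; case: (A H) => [i|] //; case: ifP => // iH.
by apply: IH; rewrite probed_rcons rcons_uniq iH.
Qed.

Lemma agrees_arun n (A : apolicy U m) x H :
  agrees x H -> agrees x (arun n A x H).
Proof.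
elim: n H => //= n IH H aH; case: (A H) => [i|] //; case: ifP => // iH.
by apply: IH; rewrite agrees_rcons.
Qed.

(* Whether [e] gets probed is decided before [x e] is revealed. *)
Lemma mem_probed_arun_upd n (A : apolicy U m) x H e v :
  (e \in probed (arun n A (upd x e v) H)) = (e \in probed (arun n A x H)).
Proof.
elim: n H => //= n IH H; case: (A H) => [i|] //; case: ifP => // iH.
have [ie|ie] := eqVneq i e; last by rewrite upd_neq.
have eP y : e \in probed (arun n A y (rcons H (i, y i))).
  by apply: mem_probed_arun; rewrite probed_rcons mem_rcons inE ie eqxx.
by rewrite !eP.
Qed.

(** The budget is tested before the probe, so it is never exceeded, and an item is still chosen
    before its value is seen. *)
Definition truncate (B : R) (A : apolicy U m) : apolicy U m := fun H =>
  if A H is Some i then if cost_of c H + c i <= B then Some i else None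
  else None.

Lemma cost_of_truncate n B (A : apolicy U m) x H :
  cost_of c H <= B -> cost_of c (arun n (truncate B A) x H) <= B.
Proof.
elim: n H => //= n IH H cH; rewrite [truncate B A H]/truncate; case: (A H) => [i|] //.
case: ifP => // ciB; case: ifP => // iH.
by apply: IH; rewrite cost_of_rcons.
Qed.

Lemma arun_truncate n B (A : apolicy U m) x H :
  cost_of c (arun n A x H) <= B -> arun n (truncate B A) x H = arun n A x H.
Proof.
elim: n H => //= n IH H; rewrite [truncate B A H]/truncate; case: (A H) => [i|] //.
case: ifP => iH cB; first by case: ifP; rewrite ?iH.
rewrite -(cost_of_rcons H i (x i)) ifT ?iH; first exact: IH.
exact: le_trans (cost_of_arun_ge _ _ _ _) cB.
Qed.
End Runs.

(** [B] is the first level, among [b] and the values of [C] above it, whose tail mass is at most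
    [u]. Below [B] the tail is heavier than [u], so raising the level raises the truncated sum at
    rate at least [u]. *)
Lemma quantile_exists (R : realType) (I : finType) (mu C : I -> R) (b u : R) :
  (forall x, 0 <= mu x) -> 0 <= u ->
  exists B, [/\ b <= B, \sum_(x | B < C x) mu x <= u &
    (B - b) * u <= \sum_x mu x * (Num.min (C x) B - Num.min (C x) b)].
Proof.
move=> mu_ge0 u_ge0; have [n] := ubnP #|[pred x | b < C x]|.
elim: n b => // n IH b; rewrite ltnS => cardb.
have [le_u|gt_u] := leP (\sum_(x | b < C x) mu x) u.
  exists b; split => //; rewrite subrr mul0r big1 // => x _.
  by rewrite subrr mulr0.
have [y0 y0P] : exists y, b < C y.
  have [y yb|none] := pickP (fun y => b < C y); first by exists y.
  by move: gt_u; rewrite big_pred0 // ltNge u_ge0.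
have [y yb ymin] := @arg_minP _ R _ y0 (fun y => b < C y) C y0P.
have [|B [yB massB costB]] := IH (C y).
  apply: leq_trans cardb; apply: proper_card; apply/properP; split.
    by apply/fintype.subsetP => x; rewrite !inE; exact: lt_trans.
  by exists y; rewrite !inE ?ltxx.
exists B; split => //; first exact: le_trans (ltW yb) yB.
(* No value of [C] lies strictly between [b] and [C y], so each [x] of the tail contributes the full
   [C y - b]. *)
have step : (C y - b) * \sum_(x | b < C x) mu x <=
    \sum_x mu x * (Num.min (C x) (C y) - Num.min (C x) b).
  rewrite mulr_sumr big_mkcond /=; apply: ler_sum => x _.
  case: ifP => [xb|/negbT]; first by rewrite (min_r (ymin _ xb)) (min_r (ltW xb)) mulrC.
  rewrite -leNgt => xb; rewrite !min_l ?subrr ?mulr0 //.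
  exact: le_trans xb (ltW yb).
have {}step : (C y - b) * u <= \sum_x mu x * (Num.min (C x) (C y) - Num.min (C x) b).
  by apply: le_trans step; rewrite ler_wpM2l ?subr_ge0 ?ltW.
have -> : (B - b) * u = (B - C y) * u + (C y - b) * u by ring.
apply: le_trans (lerD costB step) _.
rewrite -big_split /=; apply: ler_sum => x _.
by rewrite -mulrDr addrA subrK.
Qed.

(** * Cost of one greedy round *)

Section Round.
Variables (R : realType) (U : finType) (m : nat).
Variables (c : 'I_m -> R) (F : {set U} -> R) (theta : R).
Variable (mu : realization U m -> R).
Implicit Types (x : realization U m) (S : {set 'I_m}) (e : 'I_m).

Definition residual x S := F [set: U]%SET - F (img x S).
Definition unfinished S x := theta <= residual x S.
Definition mass S := \sum_(x | unfinished S x) mu x.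
Definition ratio x S v := (F (img x S :|: [set v]) - F (img x S)) / residual x S.
Definition gain S e := \sum_(x | unfinished S x) mu x * ratio x S (x e).

(** A relation, so that ties need no rule; the final clause forces the order to run through all
    items outside the initial [S]. *)
Fixpoint greedy S (L : seq 'I_m) : Prop :=
  if L is e :: L' then
    [/\ e \notin S, forall e', e' \notin S -> gain S e' / c e' <= gain S e / c e
      & greedy (e |: S) L']
  else S = [set: 'I_m]%SET.

(** Expected cost of following [L] when each realization stops once its residual is below [theta]:
    an item is paid by the mass unfinished just before it. *)
Fixpoint list_cost S (L : seq 'I_m) : R :=
  if L is e :: L' then c e * mass S + list_cost (e |: S) L' else 0.

Fixpoint list_gain S (L : seq 'I_m) : R :=
  if L is e :: L' then gain S e + list_gain (e |: S) L' else 0.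

Fixpoint path_gain x S (L : seq 'I_m) : R :=
  if L is e :: L' then
    (if unfinished S x then ratio x S (x e) else 0) + path_gain x (e |: S) L'
  else 0.

Lemma greedy_exists S : exists L, greedy S L.
Proof.
have [n] := ubnP #|~: S|; elim: n S => // n IH S; rewrite ltnS => cardS.
have [e0 e0S|none] := pickP [pred e | e \notin S]; last first.
  exists [::]; apply/setP => e; rewrite inE.
  by have /negbFE := none e.
have [e eS emax] := @arg_maxP _ R _ e0 (fun e => e \notin S) (fun e => gain S e / c e) e0S.
have [|L gL] := IH (e |: S); last by exists (e :: L); split.
apply: leq_trans cardS; apply: proper_card; rewrite properC properE.
by rewrite finset.subsetUr /=; apply/fintype.subsetPn; exists e; rewrite // !inE eqxx.
Qed.

Lemma list_gainE S L : list_gain S L = \sum_x mu x * path_gain x S L.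
Proof.
elim: L S => [|e L IH] S /=; first by rewrite big1 // => x _; rewrite mulr0.
rewrite IH /gain big_mkcond -big_split /=; apply: eq_bigr => x _.
by rewrite mulrDr; case: ifP; rewrite ?mulr0.
Qed.

Hypothesis F_mono : forall A B : {set U}, A \subset B -> F A <= F B.
Hypothesis F_submod :
  forall A B : {set U}, F (A :|: B) + F (A :&: B) <= F A + F B.
Hypothesis theta_gt0 : 0 < theta.

Lemma residualU1 x S e : residual x (e |: S) <= residual x S.
Proof. by rewrite lerB // F_mono // img_setU1 finset.subsetUl. Qed.

Lemma residual_ge0 x S : 0 <= residual x S.
Proof. by rewrite subr_ge0 F_mono // finset.subsetT. Qed.

Lemma ratio_ge0 x S v : 0 <= ratio x S v.
Proof.
by rewrite divr_ge0 ?residual_ge0 // subr_ge0 F_mono // finset.subsetUl.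
Qed.

Lemma ratioE x S e :
  unfinished S x -> ratio x S (x e) = 1 - residual x (e |: S) / residual x S.
Proof.
move=> un; have r0 : residual x S != 0 by rewrite gt_eqF // (lt_le_trans theta_gt0).
rewrite /ratio -img_setU1 -(divff r0) -mulrBl; congr (_ / _).
by rewrite /residual; ring.
Qed.

(** While unfinished, a step from residual [r] to [r'] gains [1 - r' / r <= ln (r / r')], which
    telescopes; the step that falls below [theta] gains at most 1. *)
Lemma path_gain_le x S L :
  path_gain x S L <=
    if unfinished S x then 1 + ln (residual x S / theta) else 0.
Proof.
have ge0 S' : unfinished S' x -> 0 <= 1 + ln (residual x S' / theta).
  by move=> un; rewrite addr_ge0 // ln_ge0 // ler_pdivlMr // mul1r.
elim: L S => [|e L IH] S /=; first by case: ifP => //; exact: ge0.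
have {IH} := IH (e |: S); set G := path_gain _ _ _.
case: (boolP (unfinished S x)) => [un|nun]; last first.
  rewrite add0r ifF // /unfinished; apply: contraNF nun => /le_trans; apply.
  exact: residualU1.
rewrite ratioE //.
have r0 : 0 < residual x S by rewrite (lt_le_trans theta_gt0).
case: ifP => [un'|_] GG; last first.
  have q0 : 0 <= residual x (e |: S) / residual x S.
    by rewrite divr_ge0 ?residual_ge0.
  have l0 : 0 <= ln (residual x S / theta).
    by rewrite ln_ge0 // ler_pdivlMr // mul1r.
  by move: GG q0 l0; generalize G (residual x (e |: S) / residual x S) (ln (residual x S / theta)) => *; lra.
have r'0 : 0 < residual x (e |: S) by rewrite (lt_le_trans theta_gt0).
have := @le_ln1Dx R (residual x (e |: S) / residual x S - 1).
have q0 : 0 < residual x (e |: S) / residual x S by rewrite divr_gt0.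
rewrite ltrBrDr addNr q0 addrC subrK ln_div ?posrE // => /(_ isT).
move: GG; rewrite !ln_div ?posrE //.
generalize G (residual x (e |: S) / residual x S) (ln (residual x S))
  (ln theta) (ln (residual x (e |: S))) => *; lra.
Qed.

Variables (p : 'I_m -> {ffun U -> R}) (D : R) (S0 : {set 'I_m}) (A : apolicy U m).
Hypothesis D_ge1 : 1 <= D.
Hypothesis F_range : F [set: U]%SET - F finset.set0 <= D * theta.
Hypothesis c_gt0 : forall i, 0 < c i.
Hypothesis mu_ge0 : forall x, 0 <= mu x.
Hypothesis mu_resample : resamples p mu S0.
Hypothesis A_covers :
  forall x, 0 < mu x -> F (realized (arun_full A x)) = F [set: U]%SET.

Let C x := cost_of c (arun_full A x).
Let lam : R := 1 + ln D.

Lemma lam_ge0 : 0 <= lam.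
Proof. by rewrite addr_ge0 // ln_ge0. Qed.

Lemma mass_ge0 S : 0 <= mass S.
Proof. exact: sumr_ge0. Qed.

Lemma gain_ge0 S e : 0 <= gain S e.
Proof. by apply: sumr_ge0 => x _; rewrite mulr_ge0 ?ratio_ge0. Qed.

Lemma list_gain_le S L : list_gain S L <= lam * mass S.
Proof.
rewrite list_gainE mulr_sumr [leRHS]big_mkcond /=; apply: ler_sum => x _.
have := path_gain_le x S L; case: ifP => un le1; last by rewrite mulr_ge0_le0.
rewrite [leRHS]mulrC ler_wpM2l // (le_trans le1) // lerD2l ler_ln ?posrE.
- rewrite ler_pdivrMr //; apply: le_trans F_range; rewrite lerB // F_mono //.
  exact: finset.sub0set.
- by rewrite divr_gt0 // (lt_le_trans theta_gt0).
- exact: lt_le_trans D_ge1.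
Qed.

(** Truncated at [B], [A] still completes half of the unfinished mass, so its resampled run gains at
    least [mass S ^+ 2 / (16 * D)] for a weighted cost of at most [mass S * B]. The best ratio is no
    smaller than this average one. *)
Lemma greedy_step S e B :
  S0 \subset S -> e \notin S ->
  (forall e', e' \notin S -> gain S e' / c e' <= gain S e / c e) ->
  0 <= B -> \sum_(x | B < C x) mu x <= mass S / 2 ->
  c e * mass S <= 16 * D * (gain S e * B).
Proof.
move=> S0S eS emax B_ge0 tailB.
(* Items of [S] are removed since [emax] says nothing about them; on the same [x] they add nothing
   to [img x S]. *)
pose TB x := [set i in probed (arun_full (truncate c B A) x)] :\: S.
pose q x := if unfinished S x then mu x else 0.
have q_ge0 x : 0 <= q x by rewrite /q; case: ifP.
have D_gt0 : 0 < D by apply: lt_le_trans D_ge1.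
have massE : \sum_x q x = mass S by rewrite /mass [RHS]big_mkcond.
have res_ge x : 0 < q x -> theta <= F [set: U]%SET - F (img x S).
  by rewrite /q; case: ifP => //; rewrite ltxx.
(* Truncation alters only runs of cost above [B], of mass at most [mass S / 2]; every other run of
   positive mass covers. *)
have complete : \sum_x q x <=
    2 * \sum_(x | F (img x S :|: img x (TB x)) == F [set: U]%SET) q x.
  have : \sum_x q x <= \sum_(x | F (img x S :|: img x (TB x)) == F [set: U]%SET) q x
      + \sum_(x | B < C x) mu x.
    rewrite [X in _ <= X + _]big_mkcond [X in _ <= _ + X]big_mkcond -big_split /=.
    apply: ler_sum => x _; case: ifP => [_|/negbT ncpl].
      by rewrite lerDl; case: ifP.
    rewrite add0r; have [CB|CB] := ltP B (C x).
      by rewrite /q; case: ifP.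
    rewrite leNgt; apply: contra ncpl => qx.
    have mux : 0 < mu x by move: qx; rewrite /q; case: ifP => //; rewrite ltxx.
    rewrite eq_le F_mono ?finset.subsetT //= -(A_covers mux) F_mono //.
    rewrite (realized_img (agrees_arun _ _ _)) // /TB /arun_full arun_truncate //.
    rewrite /img -imsetU imsetS //; apply/fintype.subsetP => i.
    by rewrite !inE => ->; rewrite andbT orbN.
  move: tailB; rewrite massE; set X := \sum_(x | B < _) _; set Y := \sum_(x | _ == _) _.
  generalize X Y (mass S) => *; lra.
have := resampled_gain_ge F_mono F_submod q_ge0 theta_gt0 D_gt0 F_range res_ge complete.
rewrite massE; set eta := \sum_x _ => core.
pose w i := \sum_(x | unfinished S x && (i \in TB x)) mu x.
have w_ge0 i : 0 <= w i by apply: sumr_ge0.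
have eta_le : eta <= \sum_(i in ~: S) w i * gain S i.
  (* Membership of [i] in [TB x] does not depend on [x i], and [ratio y S] does not depend on [y i].
     Both values can be redrawn, so [x i] serves as the value of [i] for [y]. *)
  have wgain i : i \notin S -> w i * gain S i =
      \sum_x \sum_y (if i \in TB x then q x * (q y * ratio y S (x i)) else 0).
    move=> iS; have iS0 : i \notin S0 by apply: contra iS; exact: (fintype.subsetP S0S).
    have un_upd x v : unfinished S (upd x i v) = unfinished S x.
      by rewrite /unfinished /residual img_upd.
    have ra_upd x v : ratio (upd x i v) S = ratio x S.
      by rewrite /ratio /residual img_upd.
    have TB_upd x v : (i \in TB (upd x i v)) = (i \in TB x).
      by rewrite !inE mem_probed_arun_upd.
    have -> : gain S i = \sum_y q y * \sum_v p i v * ratio y S v.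
      rewrite /gain (resamples_cond mu_resample iS0 un_upd ra_upd) big_mkcond.
      by apply: eq_bigr => y _; rewrite /q; case: ifP; rewrite ?mul0r.
    rewrite exchange_big mulr_sumr; apply: eq_bigr => y _ /=.
    have := resamples_cond (P := fun x => unfinished S x && (i \in TB x))
      (k := fun _ => ratio y S) mu_resample iS0.
    rewrite -mulr_suml -/(w i) => E; rewrite mulrCA -E //; last first.
      by move=> x v; rewrite un_upd TB_upd.
    rewrite mulr_sumr big_mkcond /=; apply: eq_bigr => x _.
    rewrite /q; case: (unfinished S x) => /=; case: ifP => // _.
      by rewrite mulrCA.
    by rewrite mul0r.
  rewrite (eq_bigr (fun i => \sum_x \sum_y
    (if i \in TB x then q x * (q y * ratio y S (x i)) else 0))); last first.
    by move=> i; rewrite inE => /wgain.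
  rewrite exchange_big; apply: ler_sum => x _ /=.
  rewrite exchange_big /= mulr_sumr; apply: ler_sum => y _.
  rewrite -big_mkcondr /= -mulr_sumr ler_wpM2l // -mulr_sumr ler_wpM2l //.
  rewrite -mulr_suml ler_wpM2r ?invr_ge0 ?residual_ge0 //.
  apply: le_trans (marginal_image_le F_mono F_submod _ _ _) _.
  rewrite le_eqVlt; apply/orP; left; apply/eqP; apply: eq_bigl => i.
  by rewrite !inE andbA andbb.
have wcost : \sum_(i in ~: S) w i * c i <= mass S * B.
  rewrite -massE mulr_suml.
  have -> : \sum_(i in ~: S) w i * c i =
      \sum_x q x * \sum_(i in ~: S) (if i \in TB x then c i else 0).
    under [RHS]eq_bigr => x _ do rewrite mulr_sumr.
    rewrite [RHS]exchange_big; apply: eq_bigr => i _ /=.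
    rewrite mulr_suml big_mkcond /=; apply: eq_bigr => x _.
    by rewrite /q; case: (unfinished S x) => /=; case: ifP; rewrite ?mulr0 ?mul0r.
  apply: ler_sum => x _; rewrite ler_wpM2l // -big_mkcondr /=.
  have cB : cost_of c (arun_full (truncate c B A) x) <= B.
    by apply: cost_of_truncate; rewrite // /cost_of big_nil.
  apply: le_trans cB; rewrite /cost_of [leRHS]big_uniq /=; last first.
    exact: uniq_probed_arun.
  rewrite [leLHS]big_mkcond [leRHS]big_mkcond; apply: ler_sum => i _ /=.
  rewrite !inE; case: (i \in probed _); last by rewrite !andbF.
  by case: ifP => // _; exact: ltW.
have {}eta_le : eta <= mass S * B * (gain S e / c e).
  apply: le_trans eta_le _; apply: le_trans (_ : _ <= (\sum_(i in ~: S) w i * c i) * (gain S e / c e)) _.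
    rewrite mulr_suml; apply: ler_sum => i; rewrite inE => iS.
    rewrite -mulrA ler_wpM2l // mulrC -ler_pdivrMr //; exact: emax.
  by rewrite ler_wpM2r // divr_ge0 ?gain_ge0 ?ltW.
have [->|mass0] := eqVneq (mass S) 0.
  rewrite mulr0 mulr_ge0 ?mulr_ge0 ?gain_ge0 //; exact: ltW.
have mass_gt0 : 0 < mass S by rewrite lt_def mass0 mass_ge0.
rewrite -(ler_pM2l mass_gt0) mulrCA -expr2 -ler_pdivlMl //.
apply: (le_trans core).
have -> : (c e)^-1 * (mass S * (16 * D * (gain S e * B))) =
   16 * D * (mass S * B * (gain S e / c e)) by ring.
by rewrite ler_pM2l // mulr_gt0.
Qed.

(* Abel summation against the quantiles [B] of the cost of [A]. *)
Lemma list_cost_aux S L b :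
  S0 \subset S -> greedy S L -> 0 <= b ->
  list_cost S L - 16 * D * (b * list_gain S L) <=
    32 * D * lam * \sum_x mu x * (C x - Num.min (C x) b).
Proof.
have D_gt0 : 0 < D by apply: lt_le_trans D_ge1.
elim: L S b => [|e L IH] S b S0S /=.
  move=> _ b_ge0; rewrite !mulr0 subrr; apply: mulr_ge0.
    by rewrite mulr_ge0 ?lam_ge0 // mulr_ge0 ?ltW.
  by apply: sumr_ge0 => x _; rewrite mulr_ge0 // subr_ge0 ge_min lexx.
move=> [eS emax gL] b_ge0.
have m2 : 0 <= mass S / 2 by rewrite divr_ge0 ?mass_ge0.
(* The new level starts from the current one, so the increments of the truncated cost of [A] add up
   along [L]. *)
have [B [bB tailB costB]] := quantile_exists C b mu_ge0 m2.
have B_ge0 := le_trans b_ge0 bB.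
have step := greedy_step S0S eS emax B_ge0 tailB.
have {IH} := IH (e |: S) B (fintype.subset_trans S0S (finset.subsetUr _ _)) gL B_ge0.
have := list_gain_le S (e :: L); rewrite /=.
set N := list_cost _ _; set G := list_gain _ _; set g := gain S e in step *.
set u := mass S in step costB *.
have -> : \sum_x mu x * (C x - Num.min (C x) b) =
  \sum_x mu x * (C x - Num.min (C x) B) +
  \sum_x mu x * (Num.min (C x) B - Num.min (C x) b).
  by rewrite -big_split /=; apply: eq_bigr => x _; rewrite -mulrDr addrA subrK.
move: costB step.
set Y := \sum_x mu x * (C x - _); set Z := \sum_x mu x * _.
move=> costB step gainL IH.
have bB0 : 0 <= B - b by rewrite subr_ge0.
have a1 : 16 * D * ((B - b) * (g + G)) <= 16 * D * ((B - b) * (lam * u)).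
  by rewrite ler_pM2l ?mulr_gt0 // ler_wpM2l.
have a2 : 32 * D * lam * ((B - b) * (u / 2)) <= 32 * D * lam * Z.
  by rewrite ler_wpM2l // mulr_ge0 ?lam_ge0 // mulr_ge0 ?ltW.
(* The constant is 32, twice 16, because the quantile is taken at tail mass [u / 2]. *)
have e1 : 32 * D * lam * ((B - b) * (u / 2)) = 16 * D * ((B - b) * (lam * u)) by field.
have e2 : 16 * D * ((B - b) * (g + G)) = 16 * D * (g * B) + 16 * D * (B * G) - 16 * D * (b * (g + G)).
  by ring.
move: step IH a1 a2; rewrite e1 e2 => step IH a1 a2.
apply: le_trans (_ : _ <= (N - 16 * D * (B * G)) + 16 * D * ((B - b) * (lam * u))) _; last first.
  rewrite [leRHS]mulrDr; exact: lerD IH a2.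
move: step a1; clear; generalize (16 * D * (g * B)) (16 * D * (B * G)) (16 * D * (b * (g + G)))
  (16 * D * ((B - b) * (lam * u))) (c e * u) N => *; lra.
Qed.

Lemma list_cost_le L :
  greedy S0 L ->
  list_cost S0 L <= 32 * D * (1 + ln D) * \sum_x mu x * cost_of c (arun_full A x).
Proof.
move=> gL; have := list_cost_aux (fintype.subxx _) gL (lexx 0).
rewrite mul0r mulr0 subr0 => /le_trans; apply; rewrite le_eqVlt; apply/orP; left.
apply/eqP; congr (_ * _); apply: eq_bigr => x _; congr (_ * _).
by rewrite min_r ?subr0 // cost_of_ge0.
Qed.
End Round.

(** Allows arguing conditionally: the fibres of [h] will be the histories after [k] rounds. *)
Lemma ler_sum_fibers (R : realType) (I : finType) (K : eqType) (h : I -> K)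
    (F G : I -> R) :
  (forall y, \sum_(x | h x == h y) F x <= \sum_(x | h x == h y) G x) ->
  \sum_x F x <= \sum_x G x.
Proof.
move=> fib; pose s := undup [seq h x | x : I].
have E (g : I -> R) : \sum_x g x = \sum_(k <- s) \sum_(x | h x == k) g x.
  under [RHS]eq_bigr => k _ do rewrite big_mkcond.
  rewrite exchange_big; apply: eq_bigr => x _ /=.
  rewrite (bigD1_seq (h x)) ?undup_uniq //=; last first.
    by rewrite mem_undup; apply/mapP; exists x; rewrite ?mem_enum.
  by rewrite eqxx big1 ?addr0 // => k; rewrite eq_sym => /negbTE ->.
rewrite !E big_seq [leRHS]big_seq; apply: ler_sum => k.
by rewrite mem_undup => /mapP[y _ ->]; exact: fib.
Qed.

(** The bound is free of [r]: if the last index counts, it is at most [y], and no more than that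
    many indices precede it. *)
Lemma count_le (R : realType) (r : nat) (y : R) :
  0 <= y -> \sum_(k < r) (if k%:R <= y then 1 else 0) <= 1 + y.
Proof.
move=> y0; elim: r => [|r IH]; first by rewrite big_ord0 addr_ge0.
rewrite big_ord_recr /=; case: ifP => ry; last by rewrite addr0.
rewrite [leRHS]addrC; apply: lerD => //; apply: le_trans ry.
apply: le_trans (_ : _ <= \sum_(k < r) 1) _.
  by apply: ler_sum => k _; case: ifP.
by rewrite sumr_const card_ord.
Qed.

(** * Execution of a single round *)

Section RoundRun.
Variables (U : finType) (m : nat) (stop : hist U m -> hist U m -> bool).
Implicit Types (x y : realization U m) (H G : hist U m) (L : seq 'I_m).

Lemma round_run_ext L H G x : exists T, round_run L stop H G x = G ++ T.
Proof.
elim: L G => [|i L IH] G /=; first by exists [::]; rewrite cats0.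
case: ifP => // _; case: ifP => _; first by exists [::]; rewrite cats0.
by have [T ->] := IH (rcons G (i, x i)); exists ((i, x i) :: T); rewrite cat_rcons.
Qed.

Lemma round_run_agrees L H G x : agrees x G -> agrees x (round_run L stop H G x).
Proof.
elim: L G => [|i L IH] G //= xG.
by case: ifP => _; [exact: IH|case: ifP => // _; apply: IH; rewrite agrees_rcons].
Qed.

(** The produced history records every value the round consulted, so a realization agreeing with it
    takes the same branches. *)
Lemma round_run_determined L H G x y :
  agrees y (round_run L stop H G x) ->
  round_run L stop H G y = round_run L stop H G x.
Proof.
elim: L G => [|i L IH] G //=.
case: ifP => _; first exact: IH.
case: ifP => // _ yG; have [T E] := round_run_ext L H (rcons G (i, x i)) x.
have /eqP -> : y i == x i.
  by move: yG; rewrite E agrees_cat -cats1 agrees_cat /= andbT -andbA => /and3P[].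
exact: IH.
Qed.

Lemma round_run_end L H G x :
  let G' := round_run L stop H G x in
  stop H G' \/ {subset L <= probed (H ++ G')}.
Proof.
elim: L G => [|i L IH] G /=; first by right.
have sub T : i \in probed (H ++ G) -> i \in probed (H ++ (G ++ T)).
  by rewrite catA (probed_cat (H ++ G)) mem_cat => ->.
case: ifP => iHG.
  have [?|LG] := IH G; [by left|right => j]; rewrite inE => /orP[/eqP->|/LG //].
  by have [T ->] := round_run_ext L H G x; exact: sub.
case: ifP => [?|_]; first by left.
have [?|LG] := IH (rcons G (i, x i)); [by left|right => j].
rewrite inE => /orP[/eqP->|/LG //].
have [T ->] := round_run_ext L H (rcons G (i, x i)) x.
by rewrite cat_rcons !probed_cat !mem_cat inE eqxx !orbT.
Qed.

Lemma round_run_stop L H G x : stop H G -> round_run L stop H G x = G.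
Proof. by move=> st; elim: L => //= i L ->; rewrite st if_same. Qed.
End RoundRun.

Section ListCost.
Variables (R : realType) (U : finType) (m : nat).
Variables (c : 'I_m -> R) (F : {set U} -> R) (theta : R).
Variable (mu : realization U m -> R).

Fixpoint path_cost (x : realization U m) (S : {set 'I_m}) (L : seq 'I_m) : R :=
  if L is e :: L' then
    (if unfinished F theta S x then c e else 0) + path_cost x (e |: S) L'
  else 0.

Lemma list_costE S L : list_cost c F theta mu S L = \sum_x mu x * path_cost x S L.
Proof.
elim: L S => [|e L IH] S /=; first by rewrite big1 // => x _; rewrite mulr0.
rewrite IH /mass mulr_sumr big_mkcond -big_split /=; apply: eq_bigr => x _.
by rewrite mulrDr; case: ifP; rewrite ?mulr0 // mulrC.
Qed.

Lemma greedy_spans S L : greedy c F theta mu S L -> forall i, (i \in S) || (i \in L).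
Proof.
elim: L S => [|e L IH] S /=; first by move=> -> i; rewrite inE.
move=> [_ _ /IH sp] i; have := sp i; rewrite !inE.
by case: (i == e); case: (i \in S); case: (i \in L).
Qed.

Lemma greedy_uniq S L : greedy c F theta mu S L -> uniq L && [disjoint L & S].
Proof.
elim: L S => [|e L IH] S /=; first by move=> _; rewrite disjoint_has.
move=> [eS _ /IH /andP[uL dis]]; rewrite uL andbT disjoint_cons eS /=.
apply/andP; split; last by apply: disjointWr dis; exact: finset.subsetUr.
by apply/negP => eL; have := disjointFr dis eL; rewrite !inE eqxx.
Qed.
End ListCost.

(** * The policy that repeats greedy rounds *)

Section Policy.
Variables (R : realType) (U : finType) (m : nat) (f : {set U} -> nat).
Variables (p : 'I_m -> {ffun U -> R}) (c : 'I_m -> R) (D : R).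
Hypothesis f_mono : monotone_fn f.
Hypothesis f_submod : submodular_fn f.
Hypothesis p_ge0 : forall i u, 0 <= p i u.
Hypothesis p_sum1 : forall i, \sum_(u : U) p i u = 1.
Hypothesis c_gt0 : forall i, 0 < c i.
Hypothesis all_cover : forall x : realization U m, 0 < prob p x ->
  f [set x i | i : 'I_m] = f [set: U]%SET.
Hypothesis D_ge1 : 1 <= D.
Implicit Types (x y : realization U m) (H G : hist U m) (L : seq 'I_m).

Let D_gt0 : 0 < D. Proof. exact: lt_le_trans D_ge1. Qed.

Definition remaining H : R := (f [set: U]%SET)%:R - (f (realized H))%:R.

(** The contraction of [f] by what is already realized; it stays monotone and submodular, so each
    round is a fresh instance. *)
Definition round_fn H (W : {set U}) : R := (f (W :|: realized H))%:R.
Definition round_mu H x : R := if agrees x H then prob p x else 0.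
(** The first clause handles a residual that is already zero, where the strict inequality cannot
    hold. *)
Definition round_stop H G :=
  (remaining H <= 0) || (remaining (H ++ G) < remaining H / D).

Lemma round_order_ex : exists ord : hist U m -> seq 'I_m, forall H,
  greedy c (round_fn H) (remaining H / D) (round_mu H) [set i in probed H] (ord H).
Proof.
have [ord ordP] := boolp.choice (fun H => greedy_exists c (round_fn H)
  (remaining H / D) (round_mu H) [set i in probed H]).
by exists ord.
Qed.

Lemma realized_cat H G : realized (H ++ G) = realized H :|: realized G.
Proof. by apply/setP => v; rewrite !inE map_cat mem_cat. Qed.

Lemma remaining_cat H G : remaining (H ++ G) <= remaining H.
Proof. by rewrite lerB // ler_nat f_mono // realized_cat finset.subsetUl. Qed.

Lemma remaining_ge0 H : 0 <= remaining H.
Proof. by rewrite subr_ge0 ler_nat f_mono // finset.subsetT. Qed.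

(** Integrality of [f] enters here; it caps the number of rounds that leave work to do. *)
Lemma remaining_gt0 H : 0 < remaining H -> 1 <= remaining H.
Proof.
by rewrite subr_gt0 ltr_nat => lt1; rewrite lerBrDr addrC natr1 ler_nat.
Qed.

Lemma round_fn_mono H (A B : {set U}) : A \subset B -> round_fn H A <= round_fn H B.
Proof. by move=> AB; rewrite ler_nat f_mono // finset.setSU. Qed.

Lemma round_fn_submod H (A B : {set U}) :
  round_fn H (A :|: B) + round_fn H (A :&: B) <= round_fn H A + round_fn H B.
Proof.
rewrite -!natrD ler_nat; apply: leq_trans (f_submod _ _).
by rewrite -finset.setUUl -finset.setUIl.
Qed.

Lemma prob_ge0 x : 0 <= prob p x.
Proof. by apply: prodr_ge0. Qed.

Lemma residual_remaining x H G :
  agrees x (H ++ G) ->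
  residual (round_fn H) x [set i in probed (H ++ G)] = remaining (H ++ G).
Proof.
move=> xHG; rewrite /residual /round_fn -(realized_img xHG).
congr (_%:R - _%:R); last first.
  by rewrite realized_cat -finset.setUA (finset.setUC (realized G)) finset.setUA finset.setUid.
by congr (f _); apply/finset.setUidPl; exact: finset.subsetT.
Qed.

(** Each probe happens at a residual of at least [remaining H / D], so [path_cost] charges it
    too. *)
Lemma cost_of_round_run L H G x :
  agrees x (H ++ G) -> uniq L -> [disjoint L & probed (H ++ G)] ->
  cost_of c (round_run L round_stop H G x) <=
  cost_of c G +
    path_cost c (round_fn H) (remaining H / D) x [set i in probed (H ++ G)] L.
Proof.
have pc_ge0 S L' : 0 <= path_cost c (round_fn H) (remaining H / D) x S L'.
  elim: L' S => //= e L' IH S; rewrite addr_ge0 //.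
  by case: ifP => // _; exact: ltW.
elim: L G => [|i L IH] G xHG; first by rewrite addr0.
rewrite cons_uniq => /andP[iL uL] dis.
have iHG : i \notin probed (H ++ G).
  by rewrite (disjointFr dis) // inE eqxx.
rewrite [round_run _ _ _ _ _]/= (negbTE iHG); case: ifP => [_|/negbT st].
  by rewrite lerDl.
have un : unfinished (round_fn H) (remaining H / D) [set j in probed (H ++ G)] x.
  by move: st; rewrite negb_or /unfinished residual_remaining // -leNgt => /andP[].
rewrite /= un addrA -(cost_of_rcons c G i (x i)).
have E : [set j in probed (H ++ rcons G (i, x i))] = i |: [set j in probed (H ++ G)].
  apply/setP => j; rewrite !inE -rcons_cat probed_rcons mem_rcons inE //.
rewrite -E; apply: IH => //; first by rewrite -rcons_cat agrees_rcons.
rewrite -rcons_cat probed_rcons disjoint_sym disjoint_has has_rcons negb_or iL.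
rewrite -disjoint_has disjoint_sym; move: dis; rewrite disjoint_cons => /andP[] //.
Qed.

Variable ord : hist U m -> seq 'I_m.
Hypothesis ordP : forall H,
  greedy c (round_fn H) (remaining H / D) (round_mu H) [set i in probed H] (ord H).

Definition round x H := round_run (ord H) round_stop H [::] x.
Definition state k x : hist U m := iter k (fun H => H ++ round x H) [::].

(** [A] is run from its start, whatever [H] has already probed, so the bounds for different
    histories add up to the full cost of [A]. *)
Lemma round_cost_le (A : apolicy U m) H :
  covers_wp1 p f (arun_full A) -> 0 < remaining H ->
  \sum_(x | agrees x H) prob p x * cost_of c (round x H) <=
  32 * D * (1 + ln D) * \sum_(x | agrees x H) prob p x * cost_of c (arun_full A x).
Proof.
move=> A_covers rem.
have theta_gt0 : 0 < remaining H / D by rewrite divr_gt0.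
have mu_ge0 x : 0 <= round_mu H x by rewrite /round_mu; case: ifP; rewrite // prob_ge0.
have range : round_fn H [set: U]%SET - round_fn H finset.set0 <= D * (remaining H / D).
  rewrite mulrC divfK ?gt_eqF // /round_fn finset.set0U /remaining lerB // ler_nat.
  by rewrite f_mono // finset.subsetT.
have cov x : 0 < round_mu H x ->
    round_fn H (realized (arun_full A x)) = round_fn H [set: U]%SET.
  rewrite /round_mu; case: ifP => [_ px|_]; last by rewrite ltxx.
  congr (_%:R); apply/eqP; rewrite eqn_leq; apply/andP; split.
    by apply: f_mono; rewrite finset.setSU // finset.subsetT.
  apply: leq_trans (_ : f [set: U]%SET <= _)%N.
    by apply: f_mono; exact: finset.subsetT.
  by rewrite -(A_covers _ px) f_mono // finset.subsetUl.
have := list_cost_le (@round_fn_mono H) (@round_fn_submod H) theta_gt0 D_ge1 range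
  c_gt0 mu_ge0 (resamples_agrees p_sum1 (H := H)) cov (ordP H).
rewrite list_costE => bound.
have E (g : realization U m -> R) :
    \sum_(x | agrees x H) prob p x * g x = \sum_x round_mu H x * g x.
  rewrite big_mkcond; apply: eq_bigr => x _; rewrite /round_mu.
  by case: ifP; rewrite ?mul0r.
rewrite !E; apply: le_trans bound; apply: ler_sum => x _.
rewrite /round_mu; case: ifP => [xH|_]; last by rewrite !mul0r.
apply: ler_wpM2l; first exact: prob_ge0.
have /andP[uL dis] := greedy_uniq (ordP H).
have := @cost_of_round_run (ord H) H [::] x; rewrite cats0 [cost_of c [::]]big_nil add0r.
apply => //; apply: etrans dis; apply: eq_disjoint_r => i.
by rewrite inE.
Qed.

Lemma state_agrees k x : agrees x (state k x).
Proof.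
elim: k => //= k IH; rewrite agrees_cat IH /=; exact: round_run_agrees.
Qed.

Lemma state_determined k x y : agrees y (state k x) -> state k y = state k x.
Proof.
elim: k => //= k IH; rewrite agrees_cat => /andP[/IH -> yr].
by congr (_ ++ _); exact: round_run_determined.
Qed.

Lemma round_done x H : remaining H <= 0 -> round x H = [::].
Proof. by move=> r0; rewrite /round round_run_stop // /round_stop r0. Qed.

(** For a reachable history, reaching it after [k] rounds is the same event as agreeing with it. The
    one-round bound thus applies on each fibre, and finished fibres cost nothing. *)
Lemma state_round_cost_le k (A : apolicy U m) :
  covers_wp1 p f (arun_full A) ->
  \sum_x prob p x * cost_of c (round x (state k x)) <=
  \sum_x (if 0 < remaining (state k x) then
     32 * D * (1 + ln D) * (prob p x * cost_of c (arun_full A x)) else 0).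
Proof.
move=> A_covers; apply: (ler_sum_fibers (h := state k)) => y.
have fiber x : (state k x == state k y) = agrees x (state k y).
  by apply/eqP/idP => [<-|/state_determined //]; exact: state_agrees.
have E x : agrees x (state k y) -> state k x = state k y.
  by rewrite -fiber => /eqP.
rewrite !(eq_bigl _ _ fiber); set H := state k y in fiber E *.
rewrite (eq_bigr (fun x => prob p x * cost_of c (round x H))); last first.
  by move=> x /E ->.
have [rem|rem] := ltP 0 (remaining H).
  rewrite [leRHS](eq_bigr (fun x => 32 * D * (1 + ln D) * (prob p x * cost_of c (arun_full A x)))).
    by rewrite -mulr_sumr; exact: round_cost_le.
  by move=> x /E ->; rewrite rem.
rewrite big1 => [|x _]; last by rewrite round_done // /cost_of big_nil mulr0.
by rewrite big1 // => x /E ->; rewrite ltNge rem.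
Qed.

(** A round ends by its stopping rule, which gives the factor [D], or by exhausting the items, and
    then [all_cover] leaves residual 0. *)
Lemma remaining_round k x :
  0 < prob p x -> 0 < remaining (state k x) ->
  D * remaining (state k.+1 x) <= remaining (state k x).
Proof.
move=> px rem; rewrite /=; set H := state k x in rem *.
have := round_run_end round_stop (ord H) H [::] x; rewrite -/(round x H) /=.
move=> [|LG].
  rewrite /round_stop leNgt rem /= => /ltW.
  by rewrite ler_pdivlMr // mulrC.
have xs : agrees x (H ++ round x H) by exact: (state_agrees k.+1).
suff -> : remaining (H ++ round x H) = 0 by rewrite mulr0 remaining_ge0.
rewrite /remaining (realized_img xs).
have -> : [set i in probed (H ++ round x H)] = [set: 'I_m]%SET.
  apply/setP => i; rewrite !inE.
  have /orP[] := greedy_spans (ordP H) i; last exact: LG.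
  by rewrite inE probed_cat mem_cat => ->.
have -> : img x [set: 'I_m]%SET = [set x i | i : 'I_m].
  by apply/setP => v; apply/imsetP/imsetP => -[i _ ->]; exists i; rewrite ?inE.
by rewrite all_cover // subrr.
Qed.

(** The residual starts at no more than [f [set: U]], loses a factor [D] per round and is at least 1
    while positive. *)
Lemma remaining_state k x :
  0 < prob p x -> 0 < remaining (state k x) -> D ^+ k <= (f [set: U]%SET)%:R.
Proof.
move=> px; suff le1 : D ^+ k * remaining (state k x) <= (f [set: U]%SET)%:R.
  move=> /remaining_gt0 r1; apply: le_trans le1.
  by rewrite ler_peMr // exprn_ge0 // ltW.
elim: k => [|k IH]; first by rewrite expr0 mul1r lerBlDr lerDl.
have [rem|rem] := ltP 0 (remaining (state k x)).
  rewrite exprSr -mulrA; apply: le_trans IH.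
  by rewrite ler_wpM2l ?exprn_ge0 ?remaining_round // ltW.
have -> : remaining (state k.+1 x) = 0.
  apply/eqP; rewrite eq_le remaining_ge0 andbT.
  by apply: le_trans rem; exact: remaining_cat.
by rewrite mulr0.
Qed.

Lemma cost_of_state k x :
  cost_of c (state k x) = \sum_(j < k) cost_of c (round x (state j x)).
Proof.
elim: k => [|k IH]; first by rewrite big_ord0 /cost_of big_nil.
by rewrite big_ord_recr /= cost_of_cat IH.
Qed.

Lemma rrun_state r x :
  rrun (RPolicy (fun=> ord) (fun=> round_stop) : rpolicy U m r) x = state r x.
Proof.
rewrite /rrun -[in RHS](size_enum_ord r); elim/last_ind: (enum 'I_r) => //= s k IH.
by rewrite foldl_rcons size_rcons IH.
Qed.

Lemma state_covers r x :
  (f [set: U]%SET)%:R < D ^+ r -> 0 < prob p x ->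
  f (realized (state r x)) = f [set: U]%SET.
Proof.
move=> Dr px; apply/eqP; rewrite eqn_leq f_mono ?finset.subsetT //=.
rewrite -(ler_nat R) -subr_le0 leNgt; apply/negP => /(remaining_state px).
by rewrite leNgt Dr.
Qed.

(** A realization of positive probability is charged for round [k] only if [k <= ln Q / ln D], hence
    for at most [1 + ln Q / ln D] rounds, each at the one-round rate. *)
Lemma exp_cost_state_le r (A : apolicy U m) :
  covers_wp1 p f (arun_full A) -> 1 < D -> (0 < f [set: U]%SET)%N ->
  exp_cost p c (state r) <=
  32 * D * (1 + ln D) * (1 + ln (f [set: U]%SET)%:R / ln D)
    * exp_cost p c (arun_full A).
Proof.
move=> A_covers D_gt1 Q_gt0; set Q : R := (f _)%:R.
have Q_ge1 : 1 <= Q by rewrite ler1n.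
have lnD_gt0 : 0 < ln D by exact: ln_gt0.
have K_ge0 : 0 <= 32 * D * (1 + ln D).
  by apply: mulr_ge0; [rewrite mulr_ge0 // ltW|rewrite addr_ge0 // ltW].
rewrite /exp_cost.
under eq_bigr => x _ do rewrite cost_of_state mulr_sumr.
rewrite exchange_big /=.
apply: le_trans (ler_sum _ (fun (k : 'I_r) _ => state_round_cost_le k A_covers)) _.
rewrite exchange_big mulr_sumr; apply: ler_sum => x _ /=.
have [px|] := ltP 0 (prob p x); last first.
  move=> px; have -> : prob p x = 0 by apply/eqP; rewrite eq_le px prob_ge0.
  by rewrite mul0r !mulr0 big1 // => k _; case: ifP; rewrite ?mulr0.
have cx_ge0 : 0 <= prob p x * cost_of c (arun_full A x).
  by rewrite mulr_ge0 ?prob_ge0 ?cost_of_ge0.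
set W := prob p x * _ in cx_ge0 *; set K := 32 * D * _ in K_ge0 *.
apply: le_trans (_ : _ <= \sum_(k < r) (if k%:R <= ln Q / ln D then 1 else 0) * (K * W)) _.
  apply: ler_sum => k _; case: ifP => [/(remaining_state px) DQ|_].
    suff kQ : k%:R <= ln Q / ln D by rewrite kQ mul1r.
    rewrite ler_pdivlMr // mulr_natl -lnXn // ler_ln ?posrE ?exprn_gt0 //.
    exact: lt_le_trans Q_ge1.
  by apply: mulr_ge0; [case: ifP|exact: mulr_ge0].
rewrite -mulr_suml [K * (_ + _)]mulrC -[leRHS]mulrA; apply: ler_wpM2r.
  exact: mulr_ge0.
apply: count_le.
by rewrite divr_ge0 ?ln_ge0 // ltW.
Qed.
End Policy.

(** * Choice of [D] and of the constant *)

Theorem mainTheorem1 (R : realType) :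
  exists C : R, 0 < C /\
  forall (U : finType) (f : {set U} -> nat) (m : nat)
         (p : 'I_m -> {ffun U -> R}) (c : 'I_m -> R) (r : nat),
    monotone_fn f -> submodular_fn f ->
    (forall i u, 0 <= p i u) -> (forall i, \sum_(u : U) p i u = 1) ->
    (forall i, 0 < c i) ->
    (forall x : realization U m, 0 < prob p x ->
       f [set x i | i : 'I_m] = f [set: U]%SET) ->
    (0 < r)%N ->
    exists P : rpolicy U m r,
      covers_wp1 p f (rrun P) /\
      forall A : apolicy U m, covers_wp1 p f (arun_full A) ->
        exp_cost p c (rrun P) <=
          C * powR ((f [set: U]%SET)%:R) (r%:R^-1) * (1 + ln ((f [set: U]%SET)%:R))
            * exp_cost p c (arun_full A).
Proof.
exists (96 * expR 1); split; first by rewrite mulr_gt0 // expR_gt0.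
move=> U f m p c r f_mono f_submod p_ge0 p_sum1 c_gt0 all_cover r_gt0.
(* For [Q = 0] the empty run covers at cost 0, and the right-hand side is 0 too since [powR 0]
   vanishes at a nonzero exponent. *)
have [Q0|Q_gt0] := posnP (f [set: U]%SET).
  pose P : rpolicy U m r := RPolicy (fun=> fun=> [::]) (fun=> fun=> fun=> true).
  have run0 x : rrun P x = [::].
    by rewrite /rrun; elim: (enum 'I_r) => //= k s.
  exists P; split=> [x _|A _].
    rewrite run0; apply/eqP; rewrite Q0 -leqn0 -Q0 f_mono //; exact: finset.subsetT.
  rewrite /exp_cost big1 => [|x _]; last by rewrite run0 /cost_of big_nil mulr0.
  rewrite Q0 powR0 ?invr_eq0 ?pnatr_eq0 -?lt0n //.
  by rewrite mulr0 !mul0r.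
set Q : R := (f _)%:R.
have Q_ge1 : 1 <= Q by rewrite ler1n.
have Q_gt0' : 0 < Q by exact: lt_le_trans Q_ge1.
have e_gt1 : 1 < expR 1 :> R by rewrite expR_gt1.
have r_gt0' : 0 < r%:R :> R by rewrite ltr0n.
have root_ge1 : 1 <= Q `^ r%:R^-1.
  have one : 1 `^ r%:R^-1 = 1 :> R by rewrite powR1.
  by rewrite -[leLHS]one ge0_ler_powR ?nnegrE ?invr_ge0 // ltW.
(* The factor [expR 1] makes [D ^+ r > Q] strict and gives [ln D >= 1], so that
   [ln Q / ln D <= ln Q]. *)
pose D := expR 1 * Q `^ r%:R^-1.
have D_gt1 : 1 < D by apply: (lt_le_trans e_gt1); rewrite ler_peMr ?expR_ge0.
have lnD : ln D = 1 + ln Q / r%:R.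
  rewrite /D lnM ?posrE ?expR_gt0 ?powR_gt0 // expRK ln_powR mulrC //.
have Dr : Q < D ^+ r.
  rewrite /D exprMn -[_ `^ _ ^+ r]powR_mulrn ?powR_ge0 // -powRrM mulVf ?gt_eqF //.
  rewrite powRr1 ?ltW // ltr_pMl // exprn_egt1 // -?lt0n //.
have [ord ordP] := round_order_ex f p c D.
exists (RPolicy (fun=> ord) (fun=> round_stop f D)); split=> [x px|A A_covers].
  rewrite rrun_state; by apply: (state_covers f_mono all_cover _ ordP) => //; exact: ltW.
have -> : exp_cost p c (rrun (RPolicy (fun=> ord) (fun=> round_stop f D) : rpolicy U m r))
    = exp_cost p c (state f D ord r).
  by apply: eq_bigr => x _; rewrite rrun_state.
apply: le_trans (exp_cost_state_le f_mono f_submod p_ge0 p_sum1 c_gt0 all_cover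
  (ltW D_gt1) ordP r A_covers D_gt1 Q_gt0) _.
apply: ler_wpM2r.
  apply: sumr_ge0 => x _; rewrite mulr_ge0 ?cost_of_ge0 //; exact: prodr_ge0.
rewrite -/Q; have lnQ_ge0 : 0 <= ln Q by exact: ln_ge0.
have q1 : ln Q / r%:R <= ln Q.
  by rewrite ler_pdivrMr // ler_peMr // ler1n.
have q0 : 0 <= ln Q / r%:R by rewrite divr_ge0 // ltW.
have lnD_ge1 : 1 <= ln D by rewrite lnD lerDl.
have q2 : ln Q / ln D <= ln Q.
  by rewrite ler_pdivrMr ?ler_peMr // (lt_le_trans _ lnD_ge1).
have q3 : (1 + ln D) * (1 + ln Q / ln D) = 1 + ln D + ln Q / ln D + ln Q.
  by field; rewrite gt_eqF // (lt_le_trans _ lnD_ge1).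
rewrite -mulrA q3.
(* [96 = 32 * 3]: the four terms of [q3] sum to at most [2 + 3 * ln Q], which is below
   [3 * (1 + ln Q)]. *)
have -> : 96 * expR 1 * Q `^ r%:R^-1 * (1 + ln Q) = 32 * D * (3 * (1 + ln Q)).
  by rewrite /D; ring.
rewrite ler_wpM2l //; first by rewrite mulr_ge0 // ltW // (lt_trans _ D_gt1).
move: lnQ_ge0 q1 q2; rewrite lnD.
generalize (ln Q / (1 + ln Q / r%:R)) (ln Q / r%:R) (ln Q) => *; lra.
Qed.
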